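(* Consider the one-hop wireless network model described in the context, where the channel powers $\gamma_{i,j}$ are i.i.d. with the Gamma distribution (Nakagami-$m$ fading) with p.d.f. $f(x)=x^{m-1}\frac{e^{-mx/\Omega}}{\Gamma(m)(\Omega/m)^m}$ for $x\ge0$, with parameters $m,\Omega>0$. Then the throughput of one-hop schemes is of order $\Theta(\log n)$ with high probability: the maximum over all active sets $\mathbb{S}\subset\{S_1,\dots,S_n\}$ of $T(\mathbb{S})$ is $\Theta(\log n)$.
   Context: Network model: $n$ sources $S_1,\dots,S_n$ and $n$ destinations $D_1,\dots,D_n$; $S_i$ wishes to communicate with $D_i$ in one hop. The channel power from $S_i$ to $D_j$ is $\gamma_{i,j}\ge0$; all $\gamma_{i,j}$ are i.i.d. with mean $\mu$. A subset $\mathbb{S}$ of sources is active, each with power $1$ (the others silent); $SINR_i=\frac{\gamma_{i,i}}{N_0+\sum_{S_k\in\mathbb{S},k\ne i}\gamma_{k,i}}$ for $S_i\in\mathbb{S}$ (and $0$ otherwise), with noise variance $N_0\ge0$; $D_i$ succeeds if $SINR_i>\beta$ for a fixed constant $\beta>0$. The throughput $T(\mathbb{S})$ is the number of successful destinations. Logarithms are natural. ''With high probability'' means with probability tending to $1$ as $n\to\infty$. *)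

(* Defs.v *)
From HB Require Import structures.
From mathcomp Require Import all_boot all_order all_algebra.
From mathcomp Require Import all_classical all_reals all_analysis.
Set Implicit Arguments. Unset Strict Implicit. Unset Printing Implicit Defensive.
Import Order.TTheory GRing.Theory Num.Theory.
Import numFieldNormedType.Exports.
Local Open Scope classical_set_scope.
Local Open Scope ring_scope.

Definition Gamma_fun {R : realType} (m : R) : R :=
  fine (\int[@lebesgue_measure R]_(x in `]0%R, +oo[%classic)
          ((x `^ (m - 1)) * expR (- x))%:E).

Definition nakagami_pdf {R : realType} (m Omega : R) (x : R) : R :=
  if (0 <= x) then
    (x `^ (m - 1)) * expR (- (m * x / Omega)) / (Gamma_fun m * ((Omega / m) `^ m))
  else 0.

(* Destination D_i succeeds for the active set S: SINR_i > beta, where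
   SINR_i = g i i / (N0 + sum_{k in S, k <> i} g k i).  Written without division
   (g i i > beta * (N0 + I)) so that a zero denominator means SINR = +oo. *)
Definition success {R : realType} (n : nat) (g : 'I_n -> 'I_n -> R) (N0 beta : R)
    (S : {set 'I_n}) (i : 'I_n) : bool :=
  (i \in S) && (beta * (N0 + \sum_(k in S | k != i) g k i) < g i i).

Definition throughput {R : realType} (n : nat) (g : 'I_n -> 'I_n -> R) (N0 beta : R)
    (S : {set 'I_n}) : nat :=
  #|[set i | success g N0 beta S i]|.

Definition max_throughput {R : realType} (n : nat) (g : 'I_n -> 'I_n -> R) (N0 beta : R)
    : nat :=
  \max_(S : {set 'I_n}) throughput g N0 beta S.

Definition iid_with_density {d : measure_display} {T : measurableType d} {R : realType}
    (P : probability T R) (n : nat) (g : 'I_n -> 'I_n -> T -> R) (f : R -> R) : Prop :=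
  (forall i j, measurable_fun [set: T] (g i j)) /\
  (forall i j (B : set R), measurable B ->
     P (g i j @^-1` B) = (\int[@lebesgue_measure R]_(x in B) (f x)%:E)%E) /\
  (forall B : 'I_n -> 'I_n -> set R, (forall i j, measurable (B i j)) ->
     P (\bigcap_(k in [set: 'I_n * 'I_n]) (g k.1 k.2 @^-1` B k.1 k.2)) =
     (\prod_(k : 'I_n * 'I_n) P (g k.1 k.2 @^-1` B k.1 k.2))%E).

(* Main.v *)
Require Import Defs.
From HB Require Import structures.
From mathcomp Require Import all_boot all_order all_algebra.
From mathcomp Require Import all_classical all_reals all_analysis.
From mathcomp Require Import measurable_realfun zify ring lra.
Set Implicit Arguments. Unset Strict Implicit. Unset Printing Implicit Defensive.
Import Order.TTheory GRing.Theory Num.Theory.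
Import numFieldNormedType.Exports.
Local Open Scope classical_set_scope.
Local Open Scope ring_scope.

(** Both bounds are union bounds over subsets of links.

    Upper bound: with high probability every direct link is O(log n).  If more
    than k = c2 log n receivers succeed, each of them sees a total interference
    O(log n) from the k other successful sources, so at least half of these
    k (k + 1) cross links lie below a threshold y.  As y is chosen so small that
    a given link does so with probability at most e^-6, this beats the number
    of ways to choose the receivers and the weak links.

    Lower bound: call i compatible with A if its direct link is at least
    tau = delta log n and all links between i and A lie in [1, 2].  For
    |A| <= c1 log n a given i is compatible with probability at least n^(-1/2),
    independently for distinct i outside A, so A has no compatible i with
    probability at most exp (- sqrt n / 2).  There are only exp (O (log^2 n))
    such sets A, so with high probability all of them can be extended, and a
    greedy choice yields c1 log n sources that all succeed together. *)

(** * The Nakagami law *)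

(** The Gamma integral is never evaluated. Where total mass 1 matters it is a hypothesis, and the
    final theorem treats the case where it fails as vacuous. *)
Definition nakagami_law {R : realType} (m Omega : R) (B : set R) : \bar R :=
  (\int[@lebesgue_measure R]_(x in B) (nakagami_pdf m Omega x)%:E)%E.

Lemma Gamma_fun_ge0 (R : realType) (m : R) : 0 <= Gamma_fun m.
Proof.
apply: fine_ge0; apply: integral_ge0 => x _.
by rewrite lee_fin mulr_ge0 ?powR_ge0 ?expR_ge0.
Qed.

Lemma nakagami_pdf_ge0 (R : realType) (m Omega x : R) :
  0 <= nakagami_pdf m Omega x.
Proof.
rewrite /nakagami_pdf; case: ifP => // _.
by rewrite divr_ge0 ?mulr_ge0 ?powR_ge0 ?expR_ge0 ?Gamma_fun_ge0.
Qed.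

Lemma measurable_nakagami_pdf (R : realType) (m Omega : R) :
  measurable_fun [set: R] (nakagami_pdf m Omega).
Proof.
apply: measurable_fun_ifT => //.
  by apply: measurable_fun_ler => //; exact: measurable_cst.
apply: measurable_funM => //; apply: measurable_funM.
  exact: measurable_powR.
apply: measurableT_comp => //; apply: measurableT_comp => //.
by apply: measurable_funM => //; apply: measurable_funM.
Qed.

Lemma nakagami_law_ge0 (R : realType) (m Omega : R) (B : set R) :
  (0 <= nakagami_law m Omega B)%E.
Proof. by apply: integral_ge0 => x _; rewrite lee_fin nakagami_pdf_ge0. Qed.

Lemma le_nakagami_law (R : realType) (m Omega : R) (A B : set R) :
  measurable A -> measurable B -> A `<=` B ->
  (nakagami_law m Omega A <= nakagami_law m Omega B)%E.
Proof.
move=> mA mB AB; apply: ge0_subset_integral => //.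
  apply: measurable_funTS; apply/measurable_EFinP.
  exact: measurable_nakagami_pdf.
by move=> x _; rewrite lee_fin nakagami_pdf_ge0.
Qed.

Lemma nakagami_law_lt0 (R : realType) (m Omega : R) :
  nakagami_law m Omega `]-oo, 0[ = 0%E.
Proof.
apply: integral0_eq => x /=; rewrite in_itv/= => x0.
by rewrite /nakagami_pdf leNgt x0.
Qed.

Definition nakagami_const {R : realType} (m Omega : R) : R :=
  Gamma_fun m * ((Omega / m) `^ m).

(** Division by zero returns 0, so a zero constant would make the density vanish everywhere, against
    total mass 1. *)
Lemma nakagami_const_gt0 (R : realType) (m Omega : R) :
  nakagami_law m Omega [set: R] = 1%E -> 0 < nakagami_const m Omega.
Proof.
move=> h; rewrite lt0r mulr_ge0 ?powR_ge0 ?Gamma_fun_ge0// andbT.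
apply/eqP => K0; move: h; rewrite /nakagami_law integral0_eq.
  by move=> /eqP; rewrite eq_sym onee_eq0.
move=> x _; rewrite /nakagami_pdf -/(nakagami_const _ _) K0 invr0 mulr0.
by case: ifP.
Qed.

(** For [x >= 1] the power [x ^ (m - 1)] is at least [1 / x], hence at least [exp (- x)]: it costs
    one extra unit of exponential rate. *)
Lemma nakagami_pdf_lower (R : realType) (m Omega x : R) :
  0 < m -> 0 < nakagami_const m Omega -> 1 <= x ->
  expR (- ((m / Omega + 1) * x)) / nakagami_const m Omega
    <= nakagami_pdf m Omega x.
Proof.
move=> m0 K0 x1; have x0 : 0 < x by exact: lt_le_trans x1.
rewrite /nakagami_pdf (ltW x0) ler_pM2r ?invr_gt0//.
rewrite /powR gt_eqF// -expRD ler_expR.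
have lnx0 : 0 <= ln x by exact: ln_ge0.
have lnx : ln x <= x by rewrite ltW// ln_sublinear.
have : 0 <= m * ln x by rewrite mulr_ge0// ltW.
rewrite [m * x / _]mulrAC; lra.
Qed.

Lemma nakagami_law_lower (R : realType) (m Omega x : R) (B : set R) :
  0 < m -> 0 < Omega -> 0 < nakagami_const m Omega -> 1 <= x ->
  measurable B -> `[x, x + 1] `<=` B ->
  ((expR (- ((m / Omega + 1) * (x + 1))) / nakagami_const m Omega)%:E
     <= nakagami_law m Omega B)%E.
Proof.
move=> m0 O0 K0 x1 mB xB.
have a0 : 0 < m / Omega + 1 by rewrite addr_gt0// divr_gt0.
apply: le_trans (le_nakagami_law m Omega _ mB xB) => //.
set r := expR _ / _.
have -> : r%:E = (\int[@lebesgue_measure R]_(y in `[x, (x + 1)%R]) (cst r%:E) y)%E.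
  rewrite integral_cst//= lebesgue_measure_itv/= lte_fin ltrDl ltr01.
  by rewrite -EFinD addrAC subrr add0r mule1.
apply: ge0_le_integral => //.
- by move=> y _; rewrite lee_fin divr_ge0 ?expR_ge0 ?(ltW K0).
- apply: measurable_funTS; apply/measurable_EFinP.
  exact: measurable_nakagami_pdf.
move=> y /=; rewrite in_itv/= => /andP[xy yx]; rewrite lee_fin.
apply: le_trans (nakagami_pdf_lower m0 K0 (le_trans x1 xy)).
by rewrite ler_pM2r ?invr_gt0// ler_expR lerN2 ler_pM2l.
Qed.

(** As [x >= 1], the shift to [x + 1] and the constant [K] are absorbed into the rate: [a * (x + 1)
    + ln K <= (2 * a + |ln K|) * x]. *)
Lemma nakagami_law_lower_exp (R : realType) (m Omega : R) :
  0 < m -> 0 < Omega -> 0 < nakagami_const m Omega ->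
  exists2 b : R, 0 < b & forall x (B : set R), 1 <= x -> measurable B ->
    `[x, x + 1] `<=` B -> ((expR (- (b * x)))%:E <= nakagami_law m Omega B)%E.
Proof.
move=> m0 O0 K0; set K := nakagami_const m Omega in K0 *.
pose a := m / Omega + 1; have a0 : 0 < a by rewrite addr_gt0// divr_gt0.
exists (2 * a + `|ln K|); first by rewrite ltr_wpDr// mulr_gt0.
move=> x B x1 mB xB.
apply: le_trans (nakagami_law_lower m0 O0 K0 x1 mB xB).
have KE : K^-1 = expR (- ln K) by rewrite expRN lnK ?posrE.
rewrite lee_fin -/K -/a KE -expRD ler_expR.
have := ler_norm (ln K).
have : `|ln K| <= `|ln K| * x by rewrite ler_peMr.
have : a <= a * x by rewrite ler_peMr// ltW.
lra.
Qed.

(* The polynomial factor is absorbed by half of the exponential rate, through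
   ln x <= eps x - 1 - ln eps. *)
Lemma nakagami_pdf_upper (R : realType) (m Omega : R) :
  0 < m -> 0 < Omega -> 0 < nakagami_const m Omega ->
  exists2 C : R, 0 < C & forall x, 1 <= x ->
    nakagami_pdf m Omega x <= C * expR (- (m / Omega / 2 * x)).
Proof.
move=> m0 O0 K0; set b := m / Omega; have b0 : 0 < b by rewrite divr_gt0.
pose e := b / 2 / m; have e0 : 0 < e by rewrite !divr_gt0.
exists (expR (m * (- ln e)) / nakagami_const m Omega).
  by rewrite divr_gt0// expR_gt0.
move=> x x1; have x0 : 0 < x by exact: lt_le_trans x1.
rewrite /nakagami_pdf (ltW x0) [leRHS]mulrAC ler_pM2r ?invr_gt0//.
rewrite /powR gt_eqF// -!expRD ler_expR [m * x / _]mulrAC -/b.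
have lnx0 : 0 <= ln x by exact: ln_ge0.
have lnx : ln e + ln x <= e * x.
  rewrite -lnM ?posrE// ltW// ln_sublinear//; exact: mulr_gt0.
have : m * (ln e + ln x) <= m * (e * x) by rewrite ler_pM2l.
have -> : m * (e * x) = b / 2 * x by rewrite /e; field; rewrite gt_eqF.
lra.
Qed.

(** The pointwise bound decays at rate [2 * s]. One half yields the factor [exp (- s x)]; the other
    is, up to [1 / s], the exponential density of rate [s], of total integral 1. *)
Lemma nakagami_law_tail (R : realType) (m Omega : R) :
  0 < m -> 0 < Omega -> 0 < nakagami_const m Omega ->
  exists2 C : R, 0 < C & forall x, 1 <= x ->
    (nakagami_law m Omega `]x, +oo[
       <= (C * expR (- (m / Omega / 4 * x)))%:E)%E.
Proof.
move=> m0 O0 K0; have [C C0 HC] := nakagami_pdf_upper m0 O0 K0.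
set s := m / Omega / 4; have s0 : 0 < s by rewrite !divr_gt0.
exists (C / s); first by rewrite divr_gt0.
move=> x x1; set r := C / s * _.
have r0 : 0 < r by rewrite mulr_gt0 ?expR_gt0 ?divr_gt0.
rewrite -[leRHS]mule1 -(integral_exponential_pdf s0).
have mE (D : set R) : measurable_fun D (EFin \o exponential_pdf s).
  by apply: measurable_funTS; apply/measurable_EFinP;
    exact: measurable_exponential_pdf.
have E0 y : 0 <= exponential_pdf s y by apply: exponential_pdf_ge0; exact: ltW.
apply: (@le_trans _ _ (r%:E * \int[lebesgue_measure]_(y in `]x, +oo[)
   (exponential_pdf s y)%:E)%E); last first.
  rewrite lee_wpmul2l ?lee_fin ?(ltW r0)//.
  apply: ge0_subset_integral => //; first exact: mE.
  by move=> y _; rewrite lee_fin.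
rewrite -ge0_integralZl_EFin//; last 3 first.
- by move=> y _; rewrite lee_fin.
- exact: mE.
- exact: ltW.
apply: ge0_le_integral => //.
- by move=> y _; rewrite lee_fin nakagami_pdf_ge0.
- apply: measurable_funTS; apply/measurable_EFinP.
  exact: measurable_nakagami_pdf.
- by apply: measurable_funeM; exact: mE.
move=> y /=; rewrite in_itv/= andbT => xy.
have y1 : 1 <= y by rewrite ltW// (le_lt_trans x1).
have y0 : 0 <= y by exact: le_trans y1.
rewrite -EFinM lee_fin (le_trans (HC _ y1))// exponential_pdfE// /r.
have -> : C / s * expR (- (s * x)) * (s * expR (- s * y))
  = C * (expR (- (s * x)) * expR (- s * y)) by field; rewrite gt_eqF.
rewrite ler_pM2l// -expRD ler_expR.
have : s * x <= s * y by rewrite ler_pM2l// ltW.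
have -> : m / Omega / 2 = s * 2 by rewrite /s; field; rewrite gt_eqF.
lra.
Qed.

(** Absolute continuity of the integral: a short interval carries little mass, and the density
    vanishes on the negative half-line. *)
Lemma nakagami_law_near0 (R : realType) (m Omega e : R) :
  nakagami_law m Omega [set: R] = 1%E -> 0 < e ->
  exists2 y : R, 0 < y & (nakagami_law m Omega `]-oo, y[ <= e%:E)%E.
Proof.
move=> h e0.
have f0 x : `|nakagami_pdf m Omega x| = nakagami_pdf m Omega x.
  by rewrite ger0_norm// nakagami_pdf_ge0.
have mf (D : set R) : measurable_fun D (EFin \o nakagami_pdf m Omega).
  apply: measurable_funTS; apply/measurable_EFinP.
  exact: measurable_nakagami_pdf.
have intf : lebesgue_measure.-integrable [set: R]
    (EFin \o nakagami_pdf m Omega).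
  apply/integrableP; split; first exact: mf.
  under eq_integral do rewrite /= f0.
  by rewrite [ltLHS]h ltry.
have [d [d0 Hd]] := integral_normr_continuous intf e0.
exists (d / 2); first by rewrite divr_gt0.
have mI : measurable (`[0, d / 2[ : set R) by [].
have muI : (lebesgue_measure (`[0%R, (d / 2)%R[ : set R) < d%:E)%E.
  rewrite lebesgue_measure_itv/= lte_fin divr_gt0// oppr0 addr0 lte_fin; lra.
have := ltW (Hd _ mI muI).
have -> : nakagami_law m Omega `]-oo, (d / 2)%R[
   = nakagami_law m Omega `[0%R, (d / 2)%R[.
  rewrite /nakagami_law integral_mkcond [RHS]integral_mkcond.
  apply: eq_integral => x _; rewrite !patchE !mem_setE !in_itv/=.
  rewrite /nakagami_pdf; have [x0|x0] := leP 0 x => //=.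
  by case: ifP.
rewrite /Rintegral -lee_fin fineK.
  by under eq_integral do rewrite f0.
under eq_integral do rewrite f0.
rewrite ge0_fin_numE; last exact: nakagami_law_ge0.
apply: le_lt_trans (_ : nakagami_law m Omega [set: R] < +oo)%E.
  exact: le_nakagami_law.
by rewrite h ltry.
Qed.

(** * Independent events *)

Lemma fin_union_bound (d : measure_display) (T : measurableType d)
    (R : realType) (P : probability T R) (I : finType) (D : {set I})
    (E : I -> set T) (c : R) :
  (forall i, i \in D -> measurable (E i)) ->
  (forall i, i \in D -> (P (E i) <= c%:E)%E) ->
  (P (\bigcup_(i in [set` D]) E i) <= (#|D|%:R * c)%:E)%E.
Proof.
move=> mE Ec.
have -> : [set` D] = [set` enum D].
  by apply/seteqP; split => i /=; rewrite mem_enum.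
rewrite cardE; have : {subset enum D <= D} by move=> i; rewrite mem_enum.
elim: (enum D) => [_|i s IHs sD].
  rewrite mul0r (_ : [set` [::]] = set0); last by apply/seteqP; split.
  by rewrite bigcup_set0 measure0.
have iD : i \in D by apply: sD; rewrite mem_head.
have ssD : {subset s <= D} by move=> j js; apply: sD; rewrite inE js orbT.
rewrite (_ : [set` i :: s] = i |` [set` s]); last first.
  apply/seteqP; split => j /=; rewrite inE.
    by move=> /orP[/eqP|]; [left|right].
  by move=> [->|->]; rewrite ?eqxx ?orbT.
rewrite bigcup_setU1 /= -natr1 mulrDl mul1r EFinD addeC.
apply: le_trans (measureU2 _ (mE _ iD) _) _.
  by apply: fin_bigcup_measurable => // j /= /ssD; exact: mE.
by apply: leeD; [exact: Ec|exact: IHs].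
Qed.

(** Independence passes to complements. The induction runs over mixed intersections, complementing
    one event at a time through [P (F \ E) = P F - P (F & E)]. *)
Lemma prob_bigcapC (d : measure_display) (T : measurableType d)
    (R : realType) (P : probability T R) (J : finType) (E : J -> set T)
    (p : J -> R) (mE : forall j, measurable (E j))
    (indep : forall A : {set J},
       P (\bigcap_(j in [set` A]) E j) = (\prod_(j in A) p j)%:E)
    (K : {set J}) :
  P (\bigcap_(j in [set` K]) ~` E j) = (\prod_(j in K) (1 - p j))%:E.
Proof.
suff H (s : seq J) (A : {set J}) : uniq s -> {in s, forall j, j \notin A} ->
    P ((\bigcap_(j in [set` A]) E j) `&` (\bigcap_(j in [set` s]) ~` E j))
      = ((\prod_(j in A) p j) * \prod_(j <- s) (1 - p j))%:E.
  have := H (enum K) finset.set0 (enum_uniq _) _.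
  rewrite big_set0 mul1r big_enum /= => <-; last first.
    by move=> j _; rewrite finset.in_set0.
  congr (P _); apply/seteqP; split => t /=.
    by move=> h; split => j /=; rewrite ?finset.in_set0// mem_enum => /h.
  by move=> [_ h] j jK; apply: h; rewrite /= mem_enum.
elim: s A => [|i s IHs] A /=.
  move=> _ _; rewrite big_nil mulr1 -indep; congr (P _).
  by apply/seteqP; split => t /=; [case|].
move=> /andP[is_ us] dA; rewrite big_cons.
set F := (\bigcap_(j in [set` A]) E j) `&` (\bigcap_(j in [set` s]) ~` E j).
have iA : i \notin A by apply: dA; rewrite mem_head.
have dA' : {in s, forall j, j \notin A}.
  by move=> j js; apply: dA; rewrite inE js orbT.
have -> : (\bigcap_(j in [set` A]) E j) `&`
    (\bigcap_(j in [set` i :: s]) ~` E j) = F `\` E i.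
  apply/seteqP; split => t /=.
    move=> [hA hs]; split; first split => //.
      by move=> j /= js; apply: hs; rewrite /= inE js orbT.
    by apply: hs; rewrite /= inE eqxx.
  move=> [[hA hs] hi]; split => // j /=; rewrite inE => /orP[/eqP->//|js].
  exact: hs.
have mF : measurable F.
  apply: measurableI; apply: fin_bigcap_measurable => // j _.
  exact: measurableC.
have -> : P (F `\` E i) = (P F - P (F `&` E i))%E.
  by apply: measureD => //; rewrite (le_lt_trans (probability_le1 P mF))// ltry.
have -> : F `&` E i =
    (\bigcap_(j in [set` (i |: A)%SET]) E j) `&`
    (\bigcap_(j in [set` s]) ~` E j).
  apply/seteqP; split => t /=.
    move=> [[hA hs] hi]; split => // j /=.
    by rewrite !inE => /orP[/eqP->//|]; exact: hA.
  move=> [hA hs]; split; first split => //.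
    by move=> j /= jA; apply: hA; rewrite /= !inE jA orbT.
  by apply: hA; rewrite /= !inE eqxx.
rewrite /F !IHs//; last first.
  move=> j js; rewrite !inE negb_or dA'// andbT.
  by apply: contraNN is_ => /eqP <-.
rewrite -EFinB big_setU1//=; congr EFin; ring.
Qed.

(** The independence hypothesis speaks of all links at once; links outside [Q] are given the whole
    line, which contributes a factor 1. *)
Lemma iid_bigcap (d : measure_display) (T : measurableType d) (R : realType)
    (P : probability T R) (n : nat) (g : 'I_n -> 'I_n -> T -> R) (f : R -> R)
    (B : 'I_n * 'I_n -> set R) (Q : {set 'I_n * 'I_n}) :
  iid_with_density P g f -> (forall w, measurable (B w)) ->
  P (\bigcap_(w in [set` Q]) (g w.1 w.2 @^-1` B w)) =
  (\prod_(w in Q) P (g w.1 w.2 @^-1` B w))%E.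
Proof.
move=> [mg [_ indep]] mB.
pose C i j := if (i, j) \in Q then B (i, j) else [set: R].
have mC i j : measurable (C i j) by rewrite /C; case: ifP.
have <- : (\prod_(w : 'I_n * 'I_n) P (g w.1 w.2 @^-1` C w.1 w.2))%E =
    (\prod_(w in Q) P (g w.1 w.2 @^-1` B w))%E.
  rewrite [RHS]big_mkcond/=; apply: eq_bigr => w _.
  rewrite /C -surjective_pairing; case: ifP => // _.
  by rewrite preimage_setT probability_setT.
rewrite -indep//; congr (P _); apply/seteqP; split => t /= h w.
  by move=> _; rewrite /C -surjective_pairing; case: ifP => // /h.
by move=> wQ; have := h w I; rewrite /C -surjective_pairing wQ.
Qed.

Lemma iid_link_prob (d : measure_display) (T : measurableType d)
    (R : realType) (P : probability T R) (n : nat) (g : 'I_n -> 'I_n -> T -> R)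
    (f : R -> R) (i j : 'I_n) (B : set R) :
  iid_with_density P g f -> measurable B ->
  P (g i j @^-1` B) = (\int[@lebesgue_measure R]_(x in B) (f x)%:E)%E.
Proof. by move=> [_ [dens _]]; exact: dens. Qed.

Lemma iid_preimage_measurable (d : measure_display) (T : measurableType d)
    (R : realType) (P : probability T R) (n : nat) (g : 'I_n -> 'I_n -> T -> R)
    (f : R -> R) (i j : 'I_n) (B : set R) :
  iid_with_density P g f -> measurable B -> measurable (g i j @^-1` B).
Proof. by move=> [mg _] mB; rewrite -[_ @^-1` _]setTI; exact: mg. Qed.

Lemma iid_bigcap_measurable (d : measure_display) (T : measurableType d)
    (R : realType) (P : probability T R) (n : nat) (g : 'I_n -> 'I_n -> T -> R)
    (f : R -> R) (B : 'I_n * 'I_n -> set R) (Q : {set 'I_n * 'I_n}) :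
  iid_with_density P g f -> (forall w, measurable (B w)) ->
  measurable (\bigcap_(w in [set` Q]) (g w.1 w.2 @^-1` B w)).
Proof.
move=> iid mB; apply: fin_bigcap_measurable => // w _.
exact: iid_preimage_measurable iid _.
Qed.

(* In [throughput] the comprehension is a classical set, not a [{set 'I_n}]. *)
Lemma throughputE (R : realType) (n : nat) (g : 'I_n -> 'I_n -> R)
    (N0 beta : R) (S : {set 'I_n}) :
  throughput g N0 beta S = #|[set i | success g N0 beta S i]%SET|.
Proof.
apply: eq_card => i; rewrite finset.in_set.
by apply/idP/idP => [/set_mem|]; [|exact: mem_set].
Qed.

(** The outcome matters only through a finite table of success bits, so the event is a finite union,
    over the admissible tables, of finite intersections of measurable events. *)
Lemma measurable_max_throughput (d : measure_display) (T : measurableType d)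
    (R : realType) (n : nat) (g : 'I_n -> 'I_n -> T -> R) (N0 beta : R)
    (D : set nat) :
  (forall i j, measurable_fun [set: T] (g i j)) ->
  measurable [set t | D (max_throughput (fun i j => g i j t) N0 beta)].
Proof.
move=> mg.
pose z t : {ffun {set 'I_n} * 'I_n -> bool} :=
  [ffun w => success (fun i j => g i j t) N0 beta w.1 w.2].
pose F (h : {ffun {set 'I_n} * 'I_n -> bool}) : nat :=
  \max_(S : {set 'I_n}) #|[set i | h (S, i)]%SET|.
have FE t : max_throughput (fun i j => g i j t) N0 beta = F (z t).
  apply: eq_bigr => S _; rewrite throughputE.
  by apply: eq_card => i; rewrite !inE ffunE.
have -> : [set t | D (max_throughput (fun i j => g i j t) N0 beta)] =
    \bigcup_(h in [set h | D (F h)])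
      \bigcap_(w in [set: {set 'I_n} * 'I_n])
        [set t | success (fun i j => g i j t) N0 beta w.1 w.2 = h w].
  apply/seteqP; split => t /=.
    by rewrite FE => DF; exists (z t) => //= w _; rewrite ffunE.
  move=> [h /= DF hw]; rewrite FE (_ : z t = h)//.
  by apply/ffunP => w; rewrite ffunE hw.
apply: fin_bigcup_measurable => [|h _]; first exact: finite_finset.
apply: fin_bigcap_measurable => [|w _]; first exact: finite_finset.
rewrite -[X in measurable X]setTI.
have mb : measurable_fun [set: T]
    (fun t => success (fun i j => g i j t) N0 beta w.1 w.2).
  apply: measurable_and => //; apply: measurable_fun_ltr => //.
  apply: measurable_funM => //; apply: measurable_funD => //.
  under eq_fun do rewrite -big_filter.
  by apply: measurable_sum => i.
exact: (mb measurableT [set h w]).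
Qed.

(** * Upper bound *)

Lemma exists_subset_card (T : finType) (A : {set T}) (k : nat) :
  (k <= #|A|)%N -> exists2 B : {set T}, B \subset A & #|B| = k.
Proof.
move=> kA; pose s := take k (enum A).
have sz : size s = k by rewrite size_takel// -cardE.
have us : uniq s by rewrite take_uniq// enum_uniq.
exists [set x in s]%SET; last by rewrite cardsE (card_uniqP us).
by apply/fintype.subsetP => x; rewrite inE => /mem_take; rewrite mem_enum.
Qed.

(** Each such set is the set of entries of a [k]-tuple over [option T], with [None] as padding. *)
Lemma card_sets_le (T : finType) (k : nat) :
  (#|[set A : {set T} | #|A| <= k]%SET| <= #|T|.+1 ^ k)%N.
Proof.
pose f (t : k.-tuple (option T)) := [set x | Some x \in t]%SET.
rewrite -card_option -card_tuple -cardsT.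
apply: leq_trans (leq_imset_card f _).
apply/subset_leq_card/fintype.subsetP => A; rewrite inE => Ak.
pose s := [seq Some x | x <- enum A] ++ nseq (k - #|A|) None.
have sz : size s == k by rewrite size_cat size_map size_nseq -cardE subnKC.
apply/imsetP; exists (Tuple sz) => //; apply/setP => x.
by rewrite inE mem_cat mem_nseq andbF orbF mem_map ?mem_enum// => ? ? [].
Qed.

Lemma card_sets_le_expR (R : realType) (n k : nat) : (2 <= n)%N ->
  #|[set A : {set 'I_n} | (#|A| <= k)%N]%SET|%:R
    <= expR (2 * k%:R * ln n%:R) :> R.
Proof.
move=> n2; apply: (@le_trans _ _ ((n.+1 ^ k)%:R)).
  by rewrite ler_nat -[in leqRHS](card_ord n); exact: card_sets_le.
rewrite mulrAC mulrC expRM_natl natrX.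
have n0 : (0 : R) < n%:R by rewrite ltr0n; lia.
rewrite mulrC expRM_natr lnK ?posrE//.
(* Replacing [n + 1] by [n ^ 2] is where the factor 2 in the exponent comes from. *)
have le2 : (n.+1%:R : R) <= n%:R ^+ 2 by rewrite -natrX ler_nat; nia.
by apply: lerXn2r; rewrite ?nnegrE ?exprn_ge0 ?ler0n.
Qed.

Lemma max_throughput_geP (R : realType) (n : nat) (g : 'I_n -> 'I_n -> R)
    (N0 beta : R) (k : nat) :
  (k <= max_throughput g N0 beta)%N ->
  exists S : {set 'I_n}, (k <= #|[set i | success g N0 beta S i]%SET|)%N.
Proof.
have S0 : (0 < #|{: {set 'I_n}}|)%N by apply/card_gt0P; exists finset.set0.
have [S ES] := bigop.eq_bigmax (throughput g N0 beta) S0.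
by rewrite /max_throughput ES throughputE; exists S.
Qed.

(* Each of the successful receivers tolerates few strong interferers among the
   successful set, so at least half of the cross links are weak. *)
Lemma many_weak_links (R : realType) (n : nat) (g : 'I_n -> 'I_n -> R)
    (N0 beta y L : R) (k : nat) :
  0 < beta -> 0 <= N0 -> 0 < y ->
  (forall i j, 0 <= g i j) -> (forall i, g i i <= L) ->
  2 * L <= beta * y * k%:R -> (k < max_throughput g N0 beta)%N ->
  exists2 A : {set 'I_n}, #|A| = k.+1 &
  exists2 Q : {set 'I_n * 'I_n}, Q \subset finset.setX A A &
  (k.+1 * k <= 2 * #|Q|)%N /\ forall w, w \in Q -> g w.1 w.2 < y.
Proof.
move=> b0 N00 y0 g0 gL Lk /max_throughput_geP[S /exists_subset_card[A AS Ak]].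
exists A => //.
pose Q := [set w | [&& w.1 \in A, w.2 \in A, w.1 != w.2 & g w.1 w.2 < y]]%SET.
exists Q.
  by apply/fintype.subsetP => w; rewrite !inE => /and4P[-> -> _ _].
split; last by move=> w; rewrite inE => /and4P[].
pose weak i := [set j in A | (j != i) && (g j i < y)]%SET.
pose strong i := [set j in A | (j != i) && (y <= g j i)]%SET.
have cardA i : i \in A -> (#|weak i| + #|strong i|)%N = k.
  move=> iA; have : #|(A :\ i)%SET| = k by move: Ak; rewrite (cardsD1 i) iA => -[].
  rewrite -(cardsID (weak i)) => <-; congr (_ + _)%N; apply: eq_card => j.
    by rewrite !inE; case: (j \in A); rewrite /= ?andbT ?andbF; case: (j == i).
  rewrite !inE ltNge; case: (j \in A); case: (j == i) => //=.
  by rewrite andbT negbK.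
(* Success of [i] gives [beta * y * #|strong i| < L], while [2 * L <= beta * y * k]. *)
have strongk i : i \in A -> (2 * #|strong i| <= k)%N.
  move=> iA; have := fintype.subsetP AS i iA; rewrite inE => /andP[iS].
  have -> : beta * (N0 + \sum_(j in S | j != i) g j i) =
      beta * N0 + beta * \sum_(j in S | j != i) g j i by rewrite mulrDr.
  have ASs : A \subset S.
    apply: fintype.subset_trans AS _; apply/fintype.subsetP => j.
    by rewrite inE => /andP[].
  have : y * #|strong i|%:R <= \sum_(j in S | j != i) g j i.
    rewrite mulr_natr -sumr_const.
    apply: (@le_trans _ _ (\sum_(j in strong i) g j i)).
      by apply: ler_sum => j; rewrite inE => /and3P[].
    rewrite big_mkcond [leRHS]big_mkcond; apply: ler_sum => j _.
    case: ifPn => [|_]; last by case: ifP.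
    by rewrite inE => /and3P[jA -> _]; rewrite (fintype.subsetP ASs).
  rewrite -(ler_pM2l b0) mulrA => h1 h2.
  have := gL i; have := mulr_ge0 (ltW b0) N00 => h3 h4.
  have by0 : 0 < beta * y by rewrite mulr_gt0.
  rewrite -(@ler_nat R) -(ler_pM2l by0) natrM; lra.
have weakk i : i \in A -> (k <= 2 * #|weak i|)%N.
  by move=> iA; have := cardA i iA; have := strongk i iA; lia.
(* Weak links are counted receiver by receiver. *)
have -> : #|Q| = (\sum_(i in A) #|weak i|)%N.
  rewrite -sum1_card (partition_big (fun w => w.2) (mem A)) /=; last first.
    by move=> w; rewrite inE => /and4P[].
  apply: eq_bigr => i iA; rewrite sum1dep_card.
  rewrite -(card_imset (weak i) (f := fun j => (j, i))); last by move=> ? ? [].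
  apply: eq_card => -[a b]; rewrite !inE /=; apply/idP/imsetP => /=.
    move=> /andP[/and4P[aA bA ab gab] /eqP bi]; exists a; last by rewrite bi.
    by rewrite inE aA -bi ab gab.
  move=> [j]; rewrite inE => /and3P[jA ji gji] [-> ->].
  by rewrite jA iA ji gji eqxx.
rewrite big_distrr /= -Ak -sum_nat_const.
by apply: leq_sum => i /weakk.
Qed.

(** With [l = ln n], there are at most [exp (2 (k + 1) l)] sets [A] and [2 ^ ((k + 1) ^ 2)] sets [Q]
    for each, and a given [Q] is entirely weak with probability at most [exp (- 3 k (k + 1))]. Since
    [l <= k / 3], the product is at most [exp (- l)]. *)
Lemma weak_links_prob (d : measure_display) (T : measurableType d)
    (R : realType) (P : probability T R) (n : nat) (g : 'I_n -> 'I_n -> T -> R)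
    (f : R -> R) (y : R) (k : nat) :
  iid_with_density P g f ->
  (\int[@lebesgue_measure R]_(x in `]-oo, y[) (f x)%:E <= (expR (-6))%:E)%E ->
  (2 <= n)%N -> (1 <= k)%N -> 3 * ln n%:R <= k%:R :> R ->
  (P (\bigcup_(A in [set` [set A : {set 'I_n} | #|A| == k.+1]%SET])
     \bigcup_(Q in [set` [set Q : {set 'I_n * 'I_n} |
          (Q \subset finset.setX A A) && (k.+1 * k <= 2 * #|Q|)%N]%SET])
      \bigcap_(w in [set` Q]) (g w.1 w.2 @^-1` `]-oo, y[))
    <= (n%:R^-1)%:E)%E.
Proof.
move=> iid fy n2 k1 kn.
have n0 : (0 : R) < n%:R by rewrite ltr0n; lia.
have mcap (Q : {set 'I_n * 'I_n}) :
    measurable (\bigcap_(w in [set` Q]) (g w.1 w.2 @^-1` `]-oo, y[)).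
  exact: (iid_bigcap_measurable (B := fun=> `]-oo, y[%classic) _ iid).
pose c : R := expR (- (3 * (k.+1 * k)%:R)).
have capc (Q : {set 'I_n * 'I_n}) : (k.+1 * k <= 2 * #|Q|)%N ->
    (P (\bigcap_(w in [set` Q]) (g w.1 w.2 @^-1` `]-oo, y[)) <= c%:E)%E.
  move=> kQ; rewrite (iid_bigcap (B := fun=> `]-oo, y[%classic) _ iid)//.
  pose p := fine (\int[@lebesgue_measure R]_(x in `]-oo, y[) (f x)%:E)%E.
  have pE (w : 'I_n * 'I_n) : P (g w.1 w.2 @^-1` `]-oo, y[) = p%:E.
    rewrite /p -(iid_link_prob w.1 w.2 iid)// fineK// fin_num_measure//.
    exact: iid_preimage_measurable iid _.
  under eq_bigr do rewrite pE.
  rewrite prodEFin lee_fin prodr_const.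
  (* Any link of [Q] identifies [p] with a probability, which gives its sign and its bound. *)
  have [w wQ] : exists w, w \in Q by apply/card_gt0P; lia.
  have p0 : 0 <= p by rewrite -lee_fin -(pE w) measure_ge0.
  have p6 : p <= expR (-6) by rewrite -lee_fin -(pE w) (iid_link_prob _ _ iid).
  apply: (@le_trans _ _ (expR (-6) ^+ #|Q|)).
    by apply: lerXn2r; rewrite ?nnegrE ?expR_ge0.
  rewrite -expRM_natl ler_expR.
  have : ((k.+1 * k)%:R : R) <= (2 * #|Q|)%:R by rewrite ler_nat.
  rewrite natrM; lra.
have cAc (A : {set 'I_n}) : #|A| = k.+1 ->
  (P (\bigcup_(Q in [set` [set Q : {set 'I_n * 'I_n} |
        (Q \subset finset.setX A A) && (k.+1 * k <= 2 * #|Q|)%N]%SET])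
      \bigcap_(w in [set` Q]) (g w.1 w.2 @^-1` `]-oo, y[))
    <= ((2 ^ (k.+1 * k.+1))%:R * c)%:E)%E.
  move=> Ak; apply: le_trans (fin_union_bound (c := c) _ _) _ => //.
    by move=> Q; rewrite inE => /andP[_]; exact: capc.
  rewrite lee_fin ler_wpM2r ?expR_ge0// ler_nat -Ak -cardsX -card_powerset.
  apply/subset_leq_card/fintype.subsetP => Q.
  by rewrite !inE => /andP[].
apply: le_trans (fin_union_bound (c := (2 ^ (k.+1 * k.+1))%:R * c) _ _) _.
- by move=> A _; apply: fin_bigcup_measurable => [|Q _]//; exact: finite_finset.
- by move=> A; rewrite inE => /eqP; exact: cAc.
rewrite lee_fin.
apply: (@le_trans _ _ (expR (2 * k.+1%:R * ln n%:R) *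
    (expR ((k.+1 * k.+1)%:R) * c))).
  apply: ler_pM => //; first by rewrite mulr_ge0 ?expR_ge0.
    apply: le_trans (card_sets_le_expR R k.+1 n2); rewrite ler_nat.
    apply/subset_leq_card/fintype.subsetP => A.
    by rewrite !inE => /eqP ->.
  rewrite ler_wpM2r ?expR_ge0// natrX -[(k.+1 * k.+1)%:R]mulr1 expRM_natl.
  apply: lerXn2r; rewrite ?nnegrE ?expR_ge0//.
  by have := expR_ge1Dx (1 : R); lra.
have ln0 : 0 <= ln (n%:R : R) by rewrite ln_ge0// ler1n; lia.
rewrite /c -!expRD -[leRHS]lnK ?posrE ?invr_gt0// ler_expR lnV ?posrE//.
rewrite !natrM -natr1; set x := k%:R; set l := ln _.
have x1 : 1 <= x by rewrite ler1n.
rewrite -/x -/l in kn ln0 *; nra.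
Qed.

(** Three bad events: [U0], some link is negative (a null event); [U1], some direct link exceeds
    [L]; [U2], some [k + 1] receivers have too many weak cross links. Outside them [many_weak_links]
    forbids more than [k] successes. *)
Lemma throughput_upper_bound (d : measure_display) (T : measurableType d)
    (R : realType) (P : probability T R) (n : nat) (g : 'I_n -> 'I_n -> T -> R)
    (f : R -> R) (N0 beta y s C : R) :
  iid_with_density P g f -> 0 < beta -> 0 <= N0 -> 0 < y -> 0 < s -> 0 < C ->
  (\int[@lebesgue_measure R]_(x in `]-oo, 0%R[) (f x)%:E = 0)%E ->
  (\int[@lebesgue_measure R]_(x in `]-oo, y[) (f x)%:E <= (expR (-6))%:E)%E ->
  (forall x, 1 <= x -> (\int[@lebesgue_measure R]_(z in `]x, +oo[) (f z)%:E
     <= (C * expR (- (s * x)))%:E)%E) ->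
  (2 <= n)%N -> 1 <= ln (n%:R : R) -> s / 2 <= ln n%:R ->
  (P [set t | ((4 + 4 / (s * (beta * y))) * ln n%:R
        < (max_throughput (fun i j => g i j t) N0 beta)%:R)%R]
    <= ((C + 1) / n%:R)%:E)%E.
Proof.
move=> iid b0 N00 y0 s0 C0 fneg fy ftail n2 ln1 lns.
have n0 : (0 : R) < n%:R by rewrite ltr0n; lia.
set c2 := 4 + _; set l := ln n%:R; rewrite -/l in ln1 lns.
have by0 : 0 < s * (beta * y) by rewrite !mulr_gt0.
have c2_4 : 4 < c2 by rewrite /c2 ltrDl divr_gt0.
have c2l0 : 0 <= c2 * l by rewrite mulr_ge0; lra.
pose k := Num.truncn (c2 * l).
(* Rounding down loses at most 1, hence at most [l]. What remains, [c2 - 1], covers both the 3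
   needed for counting and the [4 / (s * (beta * y))] needed for [L]. *)
have k_ge : (c2 - 1) * l <= k%:R.
  have := truncnS_gt (c2 * l); rewrite -/k -natr1; lra.
have k3 : 3 * l <= k%:R.
  by apply: le_trans k_ge; rewrite ler_wpM2r; lra.
have k1 : (1 <= k)%N by rewrite -(@ler_nat R); lra.
(* Chosen so that [s * L = 2 * l]: each direct link exceeds [L] with probability at most
   [C / n ^ 2], and the union over [n] links costs [C / n]. *)
pose L := 2 / s * l.
have L1 : 1 <= L.
  have -> : L = l / (s / 2) by rewrite /L; field; rewrite gt_eqF.
  by rewrite ler_pdivlMr ?mul1r// divr_gt0.
have Lk : 2 * L <= beta * y * k%:R.
  have -> : 2 * L = beta * y * (4 / (s * (beta * y)) * l).
    by rewrite /L; field; rewrite !gt_eqF.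
  rewrite ler_pM2l ?mulr_gt0//; apply: le_trans k_ge.
  by rewrite ler_wpM2r /c2; lra.
pose U0 := \bigcup_(w in [set` [set: 'I_n * 'I_n]%SET])
  (g w.1 w.2 @^-1` `]-oo, 0%R[).
pose U1 := \bigcup_(i in [set` [set: 'I_n]%SET]) (g i i @^-1` `]L, +oo[).
pose U2 := \bigcup_(A in [set` [set A : {set 'I_n} | #|A| == k.+1]%SET])
     \bigcup_(Q in [set` [set Q : {set 'I_n * 'I_n} |
          (Q \subset finset.setX A A) && (k.+1 * k <= 2 * #|Q|)%N]%SET])
      \bigcap_(w in [set` Q]) (g w.1 w.2 @^-1` `]-oo, y[).
have mU0 : measurable U0.
  by apply: fin_bigcup_measurable => // w _; exact: iid_preimage_measurable iid _.
have mU1 : measurable U1.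
  by apply: fin_bigcup_measurable => // w _; exact: iid_preimage_measurable iid _.
have mU2 : measurable U2.
  apply: fin_bigcup_measurable => // A _; apply: fin_bigcup_measurable => // Q _.
  exact: (iid_bigcap_measurable (B := fun=> `]-oo, y[%classic) _ iid).
have PU0 : (P U0 <= 0)%E.
  apply: le_trans (fin_union_bound (c := 0) _ _) _; last by rewrite mulr0.
    by move=> w _; exact: iid_preimage_measurable iid _.
  by move=> w _; rewrite (iid_link_prob _ _ iid)// fneg.
have PU1 : (P U1 <= (C / n%:R)%:E)%E.
  apply: le_trans (fin_union_bound (c := C * expR (- (s * L))) _ _) _.
  - by move=> w _; exact: iid_preimage_measurable iid _.
  - by move=> w _; rewrite (iid_link_prob _ _ iid)//; exact: ftail.
  rewrite lee_fin cardsT card_ord mulrCA ler_pM2l//.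
  have -> : s * L = l + l by rewrite /L; field; rewrite gt_eqF.
  rewrite opprD expRD -lnV ?posrE// lnK ?posrE ?invr_gt0//.
  by rewrite mulrA mulfV ?mul1r// gt_eqF.
have PU2 : (P U2 <= (n%:R^-1)%:E)%E by exact: weak_links_prob iid _ _ _ _.
rewrite [(C + 1) / _]mulrDl mul1r EFinD.
apply: (@le_trans _ _ (P (U0 `|` (U1 `|` U2)))).
  apply: le_measure; rewrite ?inE.
  - exact: (measurable_max_throughput N0 beta (fun q => c2 * l < q%:R) iid.1).
  - by apply: measurableU => //; exact: measurableU.
  move=> t /= cmt.
  have [|nU0] := pselect (U0 t); first by left.
  have [|nU1] := pselect (U1 t); first by right; left.
  right; right.
  have kmt : (k < max_throughput (fun i j => g i j t) N0 beta)%N.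
    by rewrite truncn_lt_nat.
  have g0 i j : 0 <= g i j t.
    rewrite leNgt; apply/negP => gij; apply: nU0.
    by exists (i, j); [rewrite /= inE|rewrite /= in_itv].
  have gL i : g i i t <= L.
    rewrite leNgt; apply/negP => gii; apply: nU1.
    by exists i; [rewrite /= inE|rewrite /= in_itv/= gii].
  have [A Ak [Q QA [Qk Qy]]] := many_weak_links b0 N00 y0 g0 gL Lk kmt.
  exists A; first by rewrite /= inE Ak.
  exists Q; first by rewrite /= inE QA Qk.
  by move=> w /= wQ; rewrite in_itv/= Qy.
apply: le_trans (measureU2 _ mU0 (measurableU _ _ mU1 mU2)) _.
rewrite -[leRHS]add0e; apply: leeD => //.
apply: le_trans (measureU2 _ mU1 mU2) _.
exact: leeD.
Qed.

(** * Lower bound *)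

(** All of [A] is activated: each receiver then sees at most [k] interferers of power at most
    [c]. *)
Lemma clique_max_throughput (R : realType) (n : nat) (g : 'I_n -> 'I_n -> R)
    (N0 beta tau c : R) (k : nat) (A : {set 'I_n}) :
  0 < beta -> #|A| = k.+1 -> beta * (N0 + c * k%:R) < tau ->
  {in A, forall i, tau <= g i i} ->
  {in A &, forall i j, i != j -> g i j <= c} ->
  (k < max_throughput g N0 beta)%N.
Proof.
move=> b0 Ak tauk gdiag goff.
apply: leq_trans (bigop.leq_bigmax A); rewrite throughputE -Ak.
apply/subset_leq_card/fintype.subsetP => i iA; rewrite inE /success iA /=.
apply: lt_le_trans (gdiag i iA); apply: le_lt_trans tauk.
rewrite ler_pM2l// lerD2l.
apply: (@le_trans _ _ (\sum_(j in A | j != i) c)).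
  by apply: ler_sum => j /andP[jA ji]; exact: goff.
have -> : \sum_(j in A | j != i) c = \sum_(j in (A :\ i)%SET) c.
  by apply: eq_bigl => j; rewrite !inE andbC.
by rewrite sumr_const mulr_natr; move: Ak; rewrite (cardsD1 i) iA add1n => -[->].
Qed.

(** Greedy growth from the empty set. The diagonal [ok i i] carries the condition on the direct
    link, so a single relation encodes both requirements. *)
Lemma extend_clique (T : finType) (ok : rel T) (k : nat) :
  (forall A : {set T}, (#|A| <= k)%N -> exists i, [/\ i \notin A, ok i i &
     {in A, forall a, ok i a && ok a i}]) ->
  exists2 A : {set T}, #|A| = k.+1 & {in A &, forall i j, ok i j}.
Proof.
move=> ext; suff H j : (j <= k.+1)%N ->
    exists2 A : {set T}, #|A| = j & {in A &, forall i j, ok i j} by exact: H.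
elim: j => [_|j IHj jk].
  by exists finset.set0; [rewrite cards0|move=> ? ?; rewrite finset.in_set0].
have [A Aj Aok] := IHj (ltnW jk).
have [|i [iA oki okA]] := ext A; first by rewrite Aj.
exists (i |: A)%SET; first by rewrite cardsU1 iA Aj.
move=> x y; rewrite !inE => /orP[/eqP->|xA] /orP[/eqP->|yA] //.
- by have /andP[] := okA _ yA.
- by have /andP[] := okA _ xA.
exact: Aok.
Qed.

(** For fixed [A], the compatibility of distinct [i] outside [A] depends on disjoint blocks of
    links, so these events are independent. Each has probability at least [rho = p * q ^ (2 k)], and
    at least [n - k] of them must fail, whence [(1 - rho) ^ (n - k) <= exp (- rho (n - k))]. *)
Lemma no_extension_prob (d : measure_display) (T : measurableType d)
    (R : realType) (P : probability T R) (n : nat) (g : 'I_n -> 'I_n -> T -> R)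
    (f : R -> R) (B : 'I_n * 'I_n -> set R) (p q : R) (k : nat)
    (A : {set 'I_n}) :
  iid_with_density P g f -> (forall w, measurable (B w)) ->
  0 < p -> 0 < q <= 1 ->
  (forall i, (p%:E <= P (g i i @^-1` B (i, i)))%E) ->
  (forall w, w.1 != w.2 -> (q%:E <= P (g w.1 w.2 @^-1` B w))%E) ->
  (#|A| <= k)%N ->
  let X w := g w.1 w.2 @^-1` B w in
  let noext := [set t | forall i, i \notin A ->
      ~ (X (i, i) t /\ forall a, a \in A -> X (i, a) t /\ X (a, i) t)] in
  measurable noext /\
  (P noext <= (expR (- (p * q ^+ (2 * k) * (n - k)%:R)))%:E)%E.
Proof.
move=> iid mB p0 /andP[q0 q1] hp hq Ak X noext.
(* On the relevant links [V], [blk] returns the endpoint outside [A]; the blocks [W i] are its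
   fibres, hence disjoint. *)
pose blk (w : 'I_n * 'I_n) := if w.1 \in A then w.2 else w.1.
pose V := [set w | (blk w \notin A) &&
  [|| w.1 == w.2, w.1 \in A | w.2 \in A]]%SET.
pose W i := [set w in V | blk w == i]%SET.
pose E i := \bigcap_(w in [set` W i]) X w.
pose pw w := fine (P (X w)).
have mX w : measurable (X w) by exact: iid_preimage_measurable iid _.
have pwE w : P (X w) = (pw w)%:E by rewrite /pw fineK// fin_num_measure.
have pw0 w : 0 <= pw w by rewrite -lee_fin -pwE measure_ge0.
have mE i : measurable (E i) by apply: fin_bigcap_measurable.
pose pE i := \prod_(w in W i) pw w.
have indep (J : {set 'I_n}) :
    P (\bigcap_(i in [set` J]) E i) = (\prod_(i in J) pE i)%:E.
  have -> : \bigcap_(i in [set` J]) E i =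
      \bigcap_(w in [set` [set w in V | blk w \in J]%SET]) X w.
    apply/seteqP; split => t /=.
      move=> h w /=; rewrite inE => /andP[wV wJ].
      by apply: (h _ wJ); rewrite /= inE wV eqxx.
    move=> h i /= iJ w; rewrite /= inE => /andP[wV /eqP wi].
    by apply: h; rewrite /= inE wV wi.
  rewrite (iid_bigcap _ iid)// (eq_bigr (fun w => (pw w)%:E)); last first.
    by move=> w _; exact: pwE.
  rewrite prodEFin; congr EFin.
  rewrite (partition_big blk (mem J)) /=; last by move=> w; rewrite inE => /andP[].
  apply: eq_bigr => i iJ; apply: eq_bigl => w; rewrite !inE.
  by case: (eqVneq (blk w) i) => [->|]; rewrite ?andbF// iJ !andbT.
have noextE : noext = \bigcap_(i in [set` (~: A)%SET]) ~` E i.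
  apply/seteqP; split => t /= h i.
    rewrite /= inE => iA Ei; apply: (h i iA); split.
      by apply: Ei; rewrite /= !inE /blk /= (negbTE iA) eqxx iA.
    move=> a aA; split; apply: Ei.
      by rewrite /= !inE /blk /= (negbTE iA) eqxx iA aA !orbT.
    by rewrite /= !inE /blk /= aA eqxx iA !orbT.
  move=> iA [Xii XA]; apply: (h i); first by rewrite /= inE.
  move=> [x y]; rewrite /= !inE /blk /=.
  case: (boolP (x \in A)) => [xA /andP[_ /eqP yi]|xA].
    by rewrite yi; have [] := XA x xA.
  move=> /andP[/andP[_ /orP[/eqP <-|/= yA]] /eqP xi]; rewrite xi//.
  by have [] := XA y yA.
have pEP i : P (E i) = (pE i)%:E.
  have := indep [set i]%SET; rewrite big_set1 => <-; congr (P _).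
  apply/seteqP; split => t /=.
    by move=> Ei j /=; rewrite inE => /eqP ->.
  by move=> /(_ i); apply; rewrite /= inE.
have pE1 i : pE i <= 1 by rewrite -lee_fin -pEP; exact: probability_le1.
have pE_ge i : i \notin A -> p * q ^+ (2 * k) <= pE i.
  move=> iA; have iW : (i, i) \in W i.
    by rewrite !inE /blk /= (negbTE iA) eqxx iA.
  rewrite /pE (big_setD1 (i, i))//=; apply: ler_pM.
  - exact: ltW.
  - by rewrite exprn_ge0// ltW.
  - by rewrite -lee_fin -pwE; exact: hp.
  (* Besides [(i, i)], the block has at most [2 * #|A|] links, all off the diagonal. *)
  apply: (@le_trans _ _ (\prod_(w in (W i :\ (i, i))%SET) q)); last first.
    apply: ler_prod => w; rewrite !inE => /and3P[wii wV /eqP wi].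
    rewrite (ltW q0) -lee_fin -pwE hq//.
    apply: contraNneq wii; case: w {wV} wi => x y /=.
    by rewrite /blk /= => + xy; rewrite -xy if_same => ->.
  rewrite prodr_const; apply: ler_wiXn2l; rewrite ?(ltW q0)//.
  apply: (@leq_trans (2 * #|A|)); last by rewrite leq_mul2l Ak orbT.
  rewrite mul2n -addnn.
  rewrite -{1}(card_imset A (f := fun a => (a, i))); last by move=> ? ? [].
  rewrite -(card_imset A (f := fun a => (i, a))); last by move=> ? ? [].
  apply: leq_trans (leq_card_setU _ _); apply/subset_leq_card/fintype.subsetP.
  move=> [x y]; rewrite !inE /blk /=.
  case: (boolP (x \in A)) => [xA /and3P[_ _ /eqP yi]|xA].
    by apply/orP; left; apply/imsetP; exists x; rewrite ?yi.
  move=> /and3P[xyi /andP[_ h] /eqP xi]; apply/orP; right; apply/imsetP.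
  exists y; last by rewrite xi.
  move: h => /orP[/eqP xy|//]; move: xyi.
  by rewrite -xy xi eqxx.
split.
  rewrite noextE; apply: fin_bigcap_measurable => // i _; exact: measurableC.
rewrite noextE (prob_bigcapC mE indep) lee_fin.
set rho := p * _.
have rho0 : 0 <= rho by rewrite mulr_ge0 ?exprn_ge0 ?ltW.
apply: (@le_trans _ _ (\prod_(i in (~: A)%SET) expR (- rho))).
  apply: ler_prod => i; rewrite inE => iA.
  have := pE_ge i iA; rewrite -/rho; have := pE1 i.
  by have := expR_ge1Dx (- rho) => ? ? ?; apply/andP; split; lra.
rewrite prodr_const -expRM_natl ler_expR mulrN lerN2 mulrC.
rewrite ler_wpM2r// ler_nat cardsCs finset.setCK card_ord; lia.
Qed.

(* The number of candidate sets is exp (O (l ^ 2)), against a failure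
   probability of order exp (- exp (l / 2) / 2), where l = ln n. *)
Lemma sets_vs_no_extension (R : realType) (c l x r : R) :
  0 < c -> 1 <= l -> 96 * (2 * c + 1) <= l -> 0 <= x -> x <= c * l ->
  expR (- (l / 2)) <= r ->
  x <= expR l /\ 2 * x * l + - (r * (expR l - x)) <= - l.
Proof.
move=> c0 l1 lc x0 xc rl.
(* The quadratic Taylor bound keeps [x] below half of [expR l]; the cubic one makes
   [expR (l / 2) / 2] at least [l ^ 3 / 96], which dominates [(2 c + 1) l ^ 2]. *)
have exp2 : l ^+ 2 / 2 <= expR l.
  have := expR_ge1Dxn 1 (_ : 0 <= l).
  rewrite (_ : 2`! = 2)%N// => /(_ ltac:(lra)); lra.
have exp3 : l ^+ 3 / 48 <= expR (l / 2).
  have := expR_ge1Dxn 2 (_ : 0 <= l / 2).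
  rewrite (_ : 3`! = 6)%N// => /(_ ltac:(lra)).
  have -> : (l / 2) ^+ 3 / 6 = l ^+ 3 / 48 by field.
  lra.
have xl : 2 * x <= expR l by apply: le_trans exp2; nra.
split; first by lra.
have : expR (- (l / 2)) * (expR l / 2) <= r * (expR l - x).
  by apply: ler_pM => //; rewrite ?divr_ge0 ?expR_ge0//; lra.
rewrite mulrA -expRD (_ : - (l / 2) + l = l / 2); last by field.
have : 2 * x * l <= 2 * c * l ^+ 2.
  rewrite (_ : 2 * c * l ^+ 2 = 2 * (c * l) * l); last by ring.
  by apply: ler_wpM2r; lra.
have : (2 * c + 1) * l ^+ 2 <= l ^+ 3 / 96.
  rewrite (_ : l ^+ 3 / 96 = l / 96 * l ^+ 2); last by field.
  by apply: ler_wpM2r; [apply: exprn_ge0|]; lra.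
have : l <= l ^+ 2 by rewrite expr2 ler_peMl//; lra.
lra.
Qed.

Lemma throughput_lower_bound (d : measure_display) (T : measurableType d)
    (R : realType) (P : probability T R) (n : nat) (g : 'I_n -> 'I_n -> T -> R)
    (f : R -> R) (N0 beta b : R) (c1 := (8 * b * (1 + 2 * beta))^-1) :
  iid_with_density P g f -> 0 < beta -> 0 <= N0 -> 0 < b ->
  (forall x (B : set R), 1 <= x -> measurable B -> `[x, x + 1] `<=` B ->
     ((expR (- (b * x)))%:E <=
       \int[@lebesgue_measure R]_(z in B) (f z)%:E)%E) ->
  (2 <= n)%N -> 1 <= ln (n%:R : R) -> 4 * b <= ln n%:R ->
  8 * b * beta * N0 < ln n%:R -> 96 * (2 * c1 + 1) <= ln n%:R ->
  (P [set t | ((max_throughput (fun i j => g i j t) N0 beta)%:R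
        < c1 * ln n%:R)%R] <= (n%:R^-1)%:E)%E.
Proof.
move=> iid b0 N00 bb0 flow n2; set l := ln _ => ln1 lb lN lc.
have n0 : (0 : R) < n%:R by rewrite ltr0n; lia.
have n_exp : n%:R = expR l by rewrite lnK ?posrE.
have den0 : 0 < 8 * b * (1 + 2 * beta) by rewrite !mulr_gt0//; lra.
have c10 : 0 < c1 by rewrite invr_gt0.
(* Each summand is at most 1. The first bounds the cost of the [2 k] cross links by [exp (- l / 4)];
   the second keeps their interference within half of [tau], the other half being left for the
   noise. *)
have c1E : 8 * (c1 * b) + 16 * (c1 * b * beta) = 1.
  transitivity (c1 * (8 * b * (1 + 2 * beta))); first by ring.
  exact: mulVf (lt0r_neq0 den0).
have cb0 : 0 < c1 * b by rewrite mulr_gt0.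
have cbb0 : 0 < c1 * b * beta by rewrite mulr_gt0.
have c1b : 2 * c1 * b <= 1 / 4 by lra.
have c1beta : 2 * beta * c1 <= (8 * b)^-1.
  by rewrite -[leRHS]mul1r ler_pdivlMr ?mulr_gt0//; lra.
have c1l0 : 0 <= c1 * l by rewrite mulr_ge0 ?(ltW c10)//; lra.
pose k := Num.truncn (c1 * l).
have kc : k%:R <= c1 * l by have /andP[] := truncn_itv c1l0.
(* A direct link reaches [tau] with probability at least [exp (- b tau) = n ^ (- 1 / 4)]. *)
pose tau := l / (4 * b).
have tau1 : 1 <= tau by rewrite ler_pdivlMr ?mul1r// mulr_gt0.
have btau : b * tau = l / 4 by rewrite /tau; field; rewrite gt_eqF.
have tauk : beta * (N0 + 2 * k%:R) < tau.
  have h1 : 2 * beta * k%:R <= (8 * b)^-1 * l.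
    apply: (@le_trans _ _ (2 * beta * c1 * l)).
      by rewrite -[leRHS]mulrA ler_pM2l ?mulr_gt0.
    by rewrite ler_wpM2r//; lra.
  have h2 : beta * N0 < (8 * b)^-1 * l.
    by rewrite [ltRHS]mulrC ltr_pdivlMr ?mulr_gt0//; lra.
  have -> : tau = (8 * b)^-1 * l + (8 * b)^-1 * l.
    by rewrite /tau; field; rewrite gt_eqF.
  lra.
(* For cross links, 1 is where the lower estimate [flow] starts to apply, and 2 caps the
   interference. *)
pose B (w : 'I_n * 'I_n) : set R :=
  if w.1 == w.2 then `[tau, +oo[%classic else `[1, 2]%classic.
have mB w : measurable (B w) by rewrite /B; case: ifP.
pose p := expR (- (l / 4)); pose q := expR (- b).
have hp i : (p%:E <= P (g i i @^-1` B (i, i)))%E.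
  rewrite (iid_link_prob _ _ iid)// /p -btau; apply: flow => // x /=.
  by rewrite /B/= eqxx /= !in_itv/= andbT => /andP[].
have hq w : w.1 != w.2 -> (q%:E <= P (g w.1 w.2 @^-1` B w))%E.
  move=> w12; rewrite (iid_link_prob _ _ iid)// /q -[b]mulr1.
  by apply: flow => // x /=; rewrite /B (negbTE w12)/= !in_itv.
have q01 : 0 < q <= 1 by rewrite expR_gt0 -expR0 ler_expR oppr_le0 ltW.
pose X w := g w.1 w.2 @^-1` B w.
pose noext (A : {set 'I_n}) := [set t | forall i, i \notin A ->
      ~ (X (i, i) t /\ forall a, a \in A -> X (i, a) t /\ X (a, i) t)].
have noextP (A : {set 'I_n}) (hA : (#|A| <= k)%N) :=
  no_extension_prob iid mB (expR_gt0 _) q01 hp hq hA.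
pose c := expR (- (p * q ^+ (2 * k) * (n - k)%:R)).
pose U := \bigcup_(A in [set` [set A : {set 'I_n} | (#|A| <= k)%N]%SET]) noext A.
have mU : measurable U.
  by apply: fin_bigcup_measurable => // A /=; rewrite inE => /noextP[].
have PU : (P U <= (#|[set A : {set 'I_n} | (#|A| <= k)%N]%SET|%:R * c)%:E)%E.
  by apply: fin_union_bound => A; rewrite inE => /noextP[].
apply: (@le_trans _ _ (P U)).
  apply: le_measure; rewrite ?inE//.
    exact: (measurable_max_throughput N0 beta (fun q => q%:R < c1 * l) iid.1).
  (* Outside [U] every set of size at most [k] extends, so some [k + 1 > c1 * l] sources succeed
     together. *)
  move=> t /= mtl; apply: contrapT => nU.
  pose ok i j := `[< X (i, j) t >].
  have [A|A Ak Aok] := @extend_clique _ ok k.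
    move=> Ak; apply: contrapT => nex; apply: nU; exists A.
      by rewrite /= inE.
    move=> i iA [Xii XA]; apply: nex; exists i; split => //; first exact/asboolP.
    by move=> a /XA[? ?]; apply/andP; split; exact/asboolP.
  have : (k < max_throughput (fun i j => g i j t) N0 beta)%N.
    apply: (clique_max_throughput b0 Ak tauk).
      move=> i iA; have /asboolP := Aok i i iA iA.
      by rewrite /X/B/= eqxx/= in_itv/= andbT.
    move=> i j iA jA ij; have /asboolP := Aok i j iA jA.
    by rewrite /X/B/= (negbTE ij)/= in_itv/= => /andP[].
  rewrite truncn_lt_nat// => h; have := lt_trans h mtl.
  by rewrite ltxx.
apply: le_trans PU _; rewrite lee_fin.
apply: (@le_trans _ _ (expR (2 * k%:R * l) * c)).
  by rewrite ler_wpM2r ?expR_ge0//; exact: card_sets_le_expR.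
rewrite -expRD n_exp -expRN ler_expR.
have rho : expR (- (l / 2)) <= p * q ^+ (2 * k).
  rewrite /p /q -expRM_natl -expRD ler_expR natrM.
  have : 2 * k%:R * b <= 1 / 4 * l; last by lra.
  apply: (@le_trans _ _ (2 * c1 * b * l)); last by rewrite ler_wpM2r//; lra.
  rewrite (_ : 2 * c1 * b * l = 2 * b * (c1 * l)); last by ring.
  by rewrite mulrAC ler_pM2l ?mulr_gt0.
have [kn expl] := sets_vs_no_extension c10 ln1 lc (ler0n _ _) kc rho.
rewrite natrB ?n_exp//.
by rewrite -(@ler_nat R) n_exp.
Qed.

(** * Passage to the limit *)

Lemma near_infty_ln_ge (R : realType) (l : R) :
  \forall n \near \oo, l <= ln (n%:R : R).
Proof.
near=> n.
have ln_ : expR l <= n%:R by near: n; exact: nbhs_infty_ger.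
by rewrite -[l]expRK ler_ln ?posrE ?(lt_le_trans _ ln_) ?expR_gt0.
Unshelve. all: by end_near. Qed.

Lemma prob_cvg1 (d : measure_display) (T : measurableType d) (R : realType)
    (P : probability T R) (E : nat -> set T) (C : R) :
  (forall n, measurable (E n)) ->
  (\forall n \near \oo, (P (~` E n) <= (C / n%:R)%:E)%E) ->
  (fun n => P (E n)) @ \oo --> 1%E.
Proof.
move=> mE PE.
apply: (@squeeze_cvge _ _ _ _ (fun n => (1 - C / n%:R)%:E) _ (fun=> 1%E)).
- near=> n; rewrite probability_le1// andbT.
  have : (P (~` E n) <= (C / n%:R)%:E)%E by near: n.
  rewrite probability_setC//.
  have /fineK <- : P (E n) \is a fin_num by rewrite fin_num_measure.
  by rewrite -EFinB !lee_fin; lra.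
- apply: cvg_EFin; first by near=> n.
  rewrite [X in _ --> X](_ : _ = 1 - C * 0); last by rewrite mulr0 subr0.
  apply: cvgB; first exact: cvg_cst.
  apply: cvgMr; apply/gtr0_cvgV0; last exact: cvgr_idn.
  by near=> n; rewrite ltr0n; near: n; exact: nbhs_infty_gt.
- exact: cvg_cst.
Unshelve. all: by end_near. Qed.

Theorem corollary5 (R : realType) (m Omega beta N0 : R)
    (hm : 0 < m) (hOmega : 0 < Omega) (hbeta : 0 < beta) (hN0 : 0 <= N0) :
  exists c1 c2 : R, 0 < c1 /\ 0 < c2 /\
  forall (d : measure_display) (T : measurableType d) (P : probability T R)
         (gamma : forall n : nat, 'I_n -> 'I_n -> T -> R),
    (forall n, iid_with_density P (gamma n) (nakagami_pdf m Omega)) ->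
    (fun n : nat => P [set t | c1 * ln n%:R <= (max_throughput (fun i j => gamma n i j t) N0 beta)%:R
                              <= c2 * ln n%:R])
      @ \oo --> 1%E.
Proof.
have [law1|law_neq1] := pselect (nakagami_law m Omega [set: R] = 1%E); last first.
  (* If the density does not have mass 1 there is no such family, as the single link for [n = 1]
     already shows; any constants will do. *)
  exists 1, 1; split=> //; split=> // d T P gamma iid; case: law_neq1.
  have := iid_link_prob ord0 ord0 (iid 1%N) measurableT.
  by rewrite preimage_setT probability_setT => ->.
have K0 := nakagami_const_gt0 law1.
have [C C0 tail] := nakagami_law_tail hm hOmega K0.
have [y y0 near0] := nakagami_law_near0 law1 (expR_gt0 (-6)).
have [b b0 lower] := nakagami_law_lower_exp hm hOmega K0.
pose s := m / Omega / 4; have s0 : 0 < s by rewrite !divr_gt0.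
pose c1 := (8 * b * (1 + 2 * beta))^-1.
pose c2 := 4 + 4 / (s * (beta * y)).
exists c1, c2; split; first by rewrite invr_gt0 !mulr_gt0//; lra.
have sby0 : 0 < s * (beta * y) by apply: mulr_gt0 => //; exact: mulr_gt0.
split; first by rewrite addr_gt0// divr_gt0.
(* The failure probabilities [1 / n] below and [(C + 1) / n] above add up to [(C + 2) / n]. *)
move=> d T P gamma iid; apply: (@prob_cvg1 _ _ _ _ _ (C + 2)).
  move=> n; exact: (measurable_max_throughput N0 beta
    (fun k => c1 * ln n%:R <= k%:R <= c2 * ln n%:R) (iid n).1).
near=> n.
have n2 : (2 <= n)%N by near: n; exact: nbhs_infty_ge.
have l1 : 1 <= ln (n%:R : R) by near: n; exact: near_infty_ln_ge.
have ls : s / 2 <= ln n%:R by near: n; exact: near_infty_ln_ge.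
have lb : 4 * b <= ln n%:R by near: n; exact: near_infty_ln_ge.
(* The added 1 provides the strict inequality required by the lower bound. *)
have lN : 8 * b * beta * N0 + 1 <= ln n%:R by near: n; exact: near_infty_ln_ge.
have lc : 96 * (2 * c1 + 1) <= ln n%:R by near: n; exact: near_infty_ln_ge.
set lo := [set t | (max_throughput (fun i j => gamma n i j t) N0 beta)%:R
   < c1 * ln n%:R].
set hi := [set t | c2 * ln n%:R
   < (max_throughput (fun i j => gamma n i j t) N0 beta)%:R].
have Plo : (P lo <= (n%:R^-1)%:E)%E.
  apply: (throughput_lower_bound (iid n) hbeta hN0 b0 lower n2 l1 lb _ lc).
  by lra.
have Phi : (P hi <= ((C + 1) / n%:R)%:E)%E.
  apply: (throughput_upper_bound (iid n) hbeta hN0 y0 s0 C0 _ near0 tail) => //.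
  exact: nakagami_law_lt0.
have mlo : measurable lo by exact: (measurable_max_throughput N0 beta
  (fun k => k%:R < c1 * ln n%:R) (iid n).1).
have mhi : measurable hi by exact: (measurable_max_throughput N0 beta
  (fun k => c2 * ln n%:R < k%:R) (iid n).1).
rewrite (_ : ~` _ = lo `|` hi); last first.
  apply/seteqP; split => t /=.
    by move=> /negP; rewrite negb_and -!ltNge => /orP.
  by move=> h; apply/negP; rewrite negb_and -!ltNge; apply/orP.
apply: le_trans (measureU2 _ mlo mhi) _.
rewrite (_ : (C + 2) / n%:R = n%:R^-1 + (C + 1) / n%:R); last by ring.
by rewrite EFinD; apply: leeD.
Unshelve. all: by end_near. Qed.
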